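(* Let $\&$ be a continuous t-norm on $[0,1]$. A real-enriched category $X$ is Smyth complete if and only if the Alexandroff real-valued topological space $\Gamma(X)$ is sober.
   Context: A continuous t-norm $\&$ is a continuous map $\&\colon[0,1]\times[0,1]\to[0,1]$, non-decreasing in each variable, such that $([0,1],\&,1)$ is a (necessarily commutative) monoid; its implication is $x\to z=\sup\{y\in[0,1]\mid x\& y\le z\}$. Suprema and infima are taken in $[0,1]$. A real-enriched category is a set $X$ with a function $X(-,-)\colon X\times X\to[0,1]$ such that $X(x,x)=1$ and $X(y,z)\& X(x,y)\le X(x,z)$ for all $x,y,z\in X$. Nets are indexed by (non-empty) directed sets. A net $\{x_i\}_{i\in D}$ of $X$ is forward Cauchy if $\sup_{i\in D}\inf_{k\ge j\ge i}X(x_j,x_k)=1$. The open ball topology of $X$ is the topology with base $\{B(x,r)\mid x\in X, r<1\}$, where $B(x,r)=\{y\in X\mid X(x,y)>r\}$. The symmetrization of $X$ is the real-enriched category on the same set with hom $\min\{X(x,y),X(y,x)\}$. $X$ is Smyth complete if each forward Cauchy net of $X$ converges uniquely (i.e. has exactly one limit) in the open ball topology of the symmetrization of $X$. A real-valued topology on a set $X$ is a map $\delta\colon X\times2^X\to[0,1]$ such that for all $x\in X$, $A,B\subseteq X$: (A1) $\delta(x,\{x\})=1$; (A2) $\delta(x,\varnothing)=0$; (A3) $\delta(x,A\cup B)=\delta(x,A)\vee\delta(x,B)$; (A4) $\delta(x,A)\ge\big(\inf_{b\in B}\delta(b,A)\big)\&\delta(x,B)$. A map $f\colon(X,\delta_X)\to(Y,\delta_Y)$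 is continuous if $\delta_X(x,A)\le\delta_Y(f(x),f(A))$ for all $x\in X$, $A\subseteq X$. Let $\delta_{\mathbb K}$ be the real-valued topology on $[0,1]$ with $\delta_{\mathbb K}(x,A)=\inf A\to x$ for $A\ne\varnothing$ and $\delta_{\mathbb K}(x,\varnothing)=0$. A closed set of $(X,\delta)$ is a continuous function $\lambda\colon(X,\delta)\to([0,1],\delta_{\mathbb K})$; $\mathcal{C}_\delta$ denotes the set of closed sets. For $\lambda,\mu\in[0,1]^X$ put $\mathrm{sub}_X(\lambda,\mu)=\inf_{x\in X}(\lambda(x)\to\mu(x))$. A closed set $\phi$ of $(X,\delta)$ is irreducible if the functor $\mathrm{sub}_X(\phi,-)\colon(\mathcal{C}_\delta,\mathrm{sub}_X)\to([0,1],\to)$ preserves finite enriched colimits; explicitly, for all $\lambda,\mu\in\mathcal{C}_\delta$ and $r\in[0,1]$: $\mathrm{sub}_X(\phi,r\&\lambda)=r\&\mathrm{sub}_X(\phi,\lambda)$ and $\mathrm{sub}_X(\phi,\lambda\vee\mu)=\mathrm{sub}_X(\phi,\lambda)\vee\mathrm{sub}_X(\phi,\mu)$. The space $(X,\delta)$ is sober if for each irreducible closed set $\phi$ there is a unique $x\in X$ with $\phi=\delta(-,\{x\})$. For a real-enriched category $X$, $\Gamma(X)$ is the set $X$ with the real-valued topology given by $\delta(x,A)=\sup_{y\in A}X(x,y)$ for $A\ne\varnothing$ and $\delta(x,\varnothing)=0$ (the Alexandroff real-valued topology of $X$). *)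

(* Defs.v *)
From HB Require Import structures.
From mathcomp Require Import all_boot all_order all_algebra.
From mathcomp Require Import all_classical all_reals topology normedtype.
Set Implicit Arguments.
Unset Strict Implicit.
Unset Printing Implicit Defensive.
Import Order.TTheory GRing.Theory Num.Theory.
Import numFieldNormedType.Exports.
Local Open Scope classical_set_scope.
Local Open Scope ring_scope.

Definition unitI (R : realType) : Type := set_type (`[0, 1]%classic : set R).

HB.instance Definition _ (R : realType) := SubChoice.on (unitI R).
HB.instance Definition _ (R : realType) :=
  Topological.copy (unitI R) (set_type (`[0, 1]%classic : set R)).
HB.instance Definition _ (R : realType) :=
  [SubChoice_isSubOrder of unitI R by <: with ring_display].

Section UnitInterval.
Variable R : realType.
Implicit Types (x y c : unitI R) (A : set (unitI R)) (f : unitI R -> unitI R).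

Lemma unitI0_subproof : (0 : R) \in (`[0, 1]%classic : set R).
Proof. by rewrite inE /= in_itv /= lexx ler01. Qed.

Lemma unitI1_subproof : (1 : R) \in (`[0, 1]%classic : set R).
Proof. by rewrite inE /= in_itv /= lexx ler01. Qed.

Definition mkI (x : R) (x01 : x \in (`[0, 1]%classic : set R)) : unitI R :=
  exist _ x x01.

Definition unitI0 : unitI R := mkI unitI0_subproof.
Definition unitI1 : unitI R := mkI unitI1_subproof.

(* Suprema and infima are taken in [0, 1]: the supremum of the empty set is 0
   and its infimum is 1. *)
Definition supI A : unitI R := supremum unitI0 A.
Definition infI A : unitI R := infimum unitI1 A.

Lemma unitI_val_ge0 x : 0 <= val x.
Proof. by have := valP x; rewrite inE /= in_itv => /andP[]. Qed.

Lemma unitI_val_le1 x : val x <= 1.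
Proof. by have := valP x; rewrite inE /= in_itv => /andP[]. Qed.

Lemma unitI_ge0 x : unitI0 <= x.
Proof. exact: unitI_val_ge0. Qed.

Lemma unitI_le1 x : x <= unitI1.
Proof. exact: unitI_val_le1. Qed.

Lemma unitI_lt01 : unitI0 < unitI1.
Proof. exact: (@ltr01 R). Qed.

Lemma unitI_has_sup A : A !=set0 -> has_sup (val @` A).
Proof.
move=> [a Aa]; split; first by exists (val a), a.
by exists 1 => _ [b _ <-]; exact: unitI_val_le1.
Qed.

Lemma unitI_has_inf A : A !=set0 -> has_inf (val @` A).
Proof.
move=> [a Aa]; split; first by exists (val a), a.
by exists 0 => _ [b _ <-]; exact: unitI_val_ge0.
Qed.

Lemma supremums_unitI A : A !=set0 -> supremums A !=set0.
Proof.
move=> A0; have [a Aa] := A0; have hs := unitI_has_sup A0.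
have s01 : sup (val @` A) \in (`[0, 1]%classic : set R).
  rewrite inE /= in_itv /=; apply/andP; split.
    apply: (le_trans (unitI_val_ge0 a)).
    by apply: ub_le_sup; [exact: hs.2|exists a].
  by apply: (ge_sup hs.1) => _ [b _ <-]; exact: unitI_val_le1.
exists (mkI s01); split => [b Ab|b ubb].
  by rewrite -[_ <= _]/(val b <= sup _); apply: (ub_le_sup hs.2); exists b.
rewrite -[_ <= _]/(sup _ <= val b).
by apply: (ge_sup hs.1) => _ [d Ad <-]; exact: ubb.
Qed.

Lemma infimums_unitI A : A !=set0 -> infimums A !=set0.
Proof.
move=> A0; have [a Aa] := A0; have hs := unitI_has_inf A0.
have s01 : inf (val @` A) \in (`[0, 1]%classic : set R).
  rewrite inE /= in_itv /=; apply/andP; split.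
    by apply: (lb_le_inf hs.1) => _ [b _ <-]; exact: unitI_val_ge0.
  apply: (le_trans _ (unitI_val_le1 a)).
  by apply: ge_inf; [exact: hs.2|exists a].
exists (mkI s01); split => [b Ab|b lbb].
  by rewrite -[_ <= _]/(inf _ <= val b); apply: (ge_inf hs.2); exists b.
rewrite -[_ <= _]/(val b <= inf _).
by apply: (lb_le_inf hs.1) => _ [d Ad <-]; exact: lbb.
Qed.

Lemma supI_ub A x : A x -> x <= supI A.
Proof.
by move=> Ax; apply: ge_supremum_Nmem => //; apply: supremums_unitI; exists x.
Qed.

Lemma infI_lb A x : A x -> infI A <= x.
Proof.
by move=> Ax; apply: le_infimum_Nmem => //; apply: infimums_unitI; exists x.
Qed.

Lemma supI_le A y : (forall x, A x -> x <= y) -> supI A <= y.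
Proof.
move=> Ay; have [->|/set0P A0] := eqVneq A set0.
  by rewrite /supI supremum0; exact: unitI_ge0.
rewrite /supI /supremum ifF; last by apply/negbTE/set0P.
by case: xgetP => [_ -> [_]|/(_ _)]; [exact|have [s] := supremums_unitI A0 => hs /(_ s)].
Qed.

Lemma le_infI A y : (forall x, A x -> y <= x) -> y <= infI A.
Proof.
move=> Ay; have [->|/set0P A0] := eqVneq A set0.
  by rewrite /infI /infimum eqxx; exact: unitI_le1.
rewrite /infI /infimum ifF; last by apply/negbTE/set0P.
by case: xgetP => [_ -> [_]|/(_ _)]; [exact|have [s] := infimums_unitI A0 => hs /(_ s)].
Qed.

Lemma nbhs_unitI x (U : set (unitI R)) : nbhs x U ->
  exists2 e : R, 0 < e & forall y, `|val x - val y| < e -> U y.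
Proof.
rewrite nbhsE => -[_ [[W oW <-] Wx] WU].
have /nbhs_ballP[e /= e0 eW] : nbhs (val x) W by exact: open_nbhs_nbhs.
by exists e => // y xy; apply: WU; exact: eW.
Qed.

Lemma unitI_dense x y : x < y -> exists2 z, x < z & z < y.
Proof.
move=> xy; have vxy : val x < val y by [].
have m01 : ((val x + val y) / 2 : R) \in (`[0, 1]%classic : set R).
  rewrite inE /= in_itv /=; apply/andP; split.
    by rewrite divr_ge0 // addr_ge0 // unitI_val_ge0.
  by rewrite ler_pdivrMr // mul1r [2]mulr2n lerD // unitI_val_le1.
by exists (mkI m01); [exact: (midf_lt vxy).1|exact: (midf_lt vxy).2].
Qed.

Lemma continuous_supI_le f A c : continuous f -> A !=set0 ->
  (forall a, A a -> f a <= c) -> f (supI A) <= c.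
Proof.
move=> fc [a0 Aa0] fA; rewrite leNgt; apply/negP => cf.
have [e e0 eU] : exists2 e : R, 0 < e &
    forall y, `|val (supI A) - val y| < e -> c < f y.
  apply: nbhs_unitI; apply: (fc (supI A) [set z | c < z]).
  apply: open_nbhs_nbhs; split => //.
  exists [set z | val c < z]; [exact: open_gt|by []].
have Ae a : A a -> val a <= val (supI A) - e.
  move=> Aa; rewrite leNgt; apply/negP => ae.
  have /eU : `|val (supI A) - val a| < e.
    rewrite ger0_norm; first by rewrite ltrBlDl -ltrBlDr.
    by rewrite subr_ge0; exact: (supI_ub Aa).
  by rewrite ltNge fA.
have s01 : val (supI A) - e \in (`[0, 1]%classic : set R).
  rewrite inE /= in_itv /= (le_trans _ (Ae _ Aa0)) ?(unitI_val_ge0 a0) //=.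
  by rewrite (le_trans _ (unitI_val_le1 (supI A))) // gerBl ltW.
have : supI A <= mkI s01 by apply: supI_le => a /Ae.
by rewrite leNgt -[_ < _]/(_ - e < _) gtrBl e0.
Qed.

Lemma continuous_infI_ge f A c : continuous f -> A !=set0 ->
  (forall a, A a -> c <= f a) -> c <= f (infI A).
Proof.
move=> fc [a0 Aa0] fA; rewrite leNgt; apply/negP => cf.
have [e e0 eU] : exists2 e : R, 0 < e &
    forall y, `|val (infI A) - val y| < e -> f y < c.
  apply: nbhs_unitI; apply: (fc (infI A) [set z | z < c]).
  apply: open_nbhs_nbhs; split => //.
  exists [set z | z < val c]; [exact: open_lt|by []].
have Ae a : A a -> val (infI A) + e <= val a.
  move=> Aa; rewrite leNgt; apply/negP => ae.
  have /eU : `|val (infI A) - val a| < e.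
    rewrite distrC ger0_norm; first by rewrite ltrBlDl.
    by rewrite subr_ge0; exact: (infI_lb Aa).
  by rewrite ltNge fA.
have s01 : val (infI A) + e \in (`[0, 1]%classic : set R).
  rewrite inE /= in_itv /= (le_trans (Ae _ Aa0)) ?(unitI_val_le1 a0) // andbT.
  by rewrite (le_trans (unitI_val_ge0 (infI A))) // lerDl ltW.
have : mkI s01 <= infI A by apply: le_infI => a /Ae.
by rewrite leNgt -[_ < _]/(_ < _ + e) ltrDl e0.
Qed.

Lemma supI_lt x y : y < x -> supI [set z | y <= z < x] = x.
Proof.
move=> yx; apply/le_anti/andP; split.
  by apply: supI_le => z /andP[_ /ltW].
rewrite leNgt; apply/negP => sx.
have [z sz zx] := unitI_dense sx.
have := @supI_ub [set z | y <= z < x] z; rewrite leNgt sz => /(_ _).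
have yz : y <= z.
  by rewrite (le_trans _ (ltW sz)) //; apply: supI_ub; rewrite /= lexx.
by rewrite /= yz zx => /(_ isT).
Qed.

Lemma infI_gt x : x < unitI1 -> infI [set z | x < z] = x.
Proof.
move=> x1; apply/le_anti/andP; split; last by apply: le_infI => z /ltW.
rewrite leNgt; apply/negP => xi; have [z xz zi] := unitI_dense xi.
by have := @infI_lb [set z | x < z] z xz; rewrite leNgt zi.
Qed.

Lemma unitI_ivt f x : continuous f -> f unitI0 <= x -> x <= f unitI1 ->
  exists t, f t = x.
Proof.
move=> fc f0 f1; pose S := [set t | f t <= x]; exists (supI S).
have S0 : S !=set0 by exists unitI0.
have fs : f (supI S) <= x by apply: continuous_supI_le.
apply/le_anti; rewrite fs /=.
have [s1|] := ltP (supI S) unitI1; last first.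
  by move=> s1; have -> // : supI S = unitI1; apply/le_anti; rewrite unitI_le1.
rewrite -(infI_gt s1); apply: continuous_infI_ge => //; first by exists unitI1.
move=> t /= st; rewrite leNgt; apply/negP => /ltW /(@supI_ub S).
by rewrite leNgt st.
Qed.

End UnitInterval.

(* Commutativity is a consequence of these axioms, see [tnormC]. *)
Record tnorm (R : realType) := TNorm {
  tnorm_op :> unitI R -> unitI R -> unitI R;
  tnorm_continuous :
    continuous (fun p : unitI R * unitI R => tnorm_op p.1 p.2);
  tnorm_homol : forall y, {homo tnorm_op^~ y : x z / x <= z};
  tnorm_homor : forall x, {homo tnorm_op x : y z / y <= z};
  tnormA : associative tnorm_op;
  tnorm1x : left_id (unitI1 R) tnorm_op;
  tnormx1 : right_id (unitI1 R) tnorm_op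
}.

Definition tnorm_imp (R : realType) (T : tnorm R) (x z : unitI R) : unitI R :=
  supI [set y | T x y <= z].

Section TNormTheory.
Variables (R : realType) (T : tnorm R).
Implicit Types x y z e c : unitI R.
Local Notation "0" := (unitI0 R).
Local Notation "1" := (unitI1 R).

Lemma tnorm_le x x' y y' : x <= x' -> y <= y' -> T x y <= T x' y'.
Proof.
by move=> xx' yy'; apply: le_trans (tnorm_homol T _ xx') (tnorm_homor T _ yy').
Qed.

Lemma tnorm_lel x y : T x y <= x.
Proof. by rewrite -{2}[x](tnormx1 T) tnorm_homor// unitI_le1. Qed.

Lemma tnorm_ler x y : T x y <= y.
Proof. by rewrite -{2}[y](tnorm1x T) tnorm_homol// unitI_le1. Qed.

Lemma tnorm0x x : T 0 x = 0.
Proof. by apply/le_anti; rewrite tnorm_lel unitI_ge0. Qed.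

Lemma tnormx0 x : T x 0 = 0.
Proof. by apply/le_anti; rewrite tnorm_ler unitI_ge0. Qed.

Lemma tnorm_continuous2 (f g : unitI R -> unitI R) :
  continuous f -> continuous g -> continuous (fun x => T (f x) (g x)).
Proof.
move=> fc gc x; apply: (@continuous_comp _ _ _ (fun x => (f x, g x))
  (fun p : unitI R * unitI R => T p.1 p.2)); last exact: tnorm_continuous.
exact: (cvg_pair (fc x) (gc x)).
Qed.

Lemma tnorm_continuousl y : continuous (T^~ y).
Proof. by apply: tnorm_continuous2; [move=> x; exact: cvg_id|exact: cst_continuous]. Qed.

Lemma tnorm_continuousr x : continuous (T x).
Proof. by apply: tnorm_continuous2; [exact: cst_continuous|move=> y; exact: cvg_id]. Qed.

Lemma tnorm_supI_le x (A : set (unitI R)) c :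
  (forall a, A a -> T x a <= c) -> T x (supI A) <= c.
Proof.
have [->|/set0P A0] := eqVneq A set0.
  by rewrite /supI supremum0 tnormx0 unitI_ge0.
by apply: continuous_supI_le => //; exact: tnorm_continuousr.
Qed.

Lemma tnorm_impP x y z : (y <= tnorm_imp T x z) = (T x y <= z).
Proof.
apply/idP/idP => [yi|xyz]; last exact: supI_ub.
by apply: le_trans (tnorm_homor T x yi) _; exact: tnorm_supI_le.
Qed.

Lemma tnorm_idemE x e : T e e = e -> x <= e -> T x e = x /\ T e x = x.
Proof.
move=> ee xe; split.
  have [||t <-] := unitI_ivt (@tnorm_continuousl e) (x := x).
  - by rewrite tnorm0x unitI_ge0.
  - by rewrite tnorm1x.
  by rewrite -tnormA ee.
have [||t <-] := unitI_ivt (@tnorm_continuousr e) (x := x).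
- by rewrite tnormx0 unitI_ge0.
- by rewrite tnormx1.
by rewrite tnormA ee.
Qed.

Let pow c n := iter n (T c) 1.

Let powD c m n : pow c (m + n) = T (pow c m) (pow c n).
Proof. by elim: m => [|m IH]; rewrite ?tnorm1x // addSn /= IH tnormA. Qed.

Let pow_squeeze c x : (forall e, T e e = e -> x <= e -> e <= c -> False) ->
  x <= c -> exists n, pow c n.+1 <= x <= pow c n.
Proof.
move=> noe xc.
have [n nx] : exists n, pow c n < x.
  apply: contrapT => /forallNP npx.
  pose L := infI (range (pow c)).
  have L0 : range (pow c) !=set0 by exists (pow c 0), 0%N.
  apply: (noe L).
  - apply/le_anti; rewrite tnorm_lel /=.
    apply: (@continuous_infI_ge _ (fun z => T z z)) => //.
      by apply: tnorm_continuous2 => z; exact: cvg_id.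
    by move=> _ [n _ <-]; rewrite -powD; apply: infI_lb; exists (n + n)%N.
  - by apply: le_infI => _ [n _ <-]; rewrite leNgt; apply/negP/npx.
  - by apply: infI_lb; exists 1%N => //=; rewrite /pow /= tnormx1.
elim: n nx => [|n IH] nx; first by move: nx; rewrite /pow /= ltNge unitI_le1.
have [/IH//|xn] := ltP (pow c n) x.
by exists n; rewrite (ltW nx).
Qed.

Let tnormC_le x y : (forall e, T e e = e -> x <= e -> e <= y -> False) ->
  x <= y -> T x y <= T y x /\ T y x <= T x y.
Proof.
move=> noe xy.
pose E := [set e | T e e = e /\ y <= e]; pose b := infI E.
have yb : y <= b by apply: le_infI => e [].
have bb : T b b = b.
  apply/le_anti; rewrite tnorm_lel /=.
  apply: (@continuous_infI_ge _ (fun z => T z z)).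
  - by apply: tnorm_continuous2 => z; exact: cvg_id.
  - by exists 1; split; [rewrite tnorm1x|exact: unitI_le1].
  - by move=> e [ee ye]; rewrite ee; apply: infI_lb.
have ltyb : y < b.
  by rewrite lt_neqAle yb andbT; apply/eqP => ey; apply: (noe b); rewrite // -ey.
have squeeze u v c : y <= c < b ->
    (u = x /\ v = y) \/ (u = y /\ v = x) -> T (T u v) (T c c) <= T v u.
  move=> /andP[yc cb] uv.
  have noc e : T e e = e -> x <= e -> e <= c -> False.
    move=> ee xe ec; have [/(noe e ee xe)//|/ltW ye] := leP e y.
    by have := @infI_lb _ E e (conj ee ye); rewrite leNgt (le_lt_trans ec cb).
  have [m /andP[xm mx]] := pow_squeeze noc (le_trans xy yc).
  have [k /andP[yk ky]] : exists k, pow c k.+1 <= y <= pow c k.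
    by apply: pow_squeeze => // e ee ye; exact: noc (le_trans xy ye).
  have ccE : T c c = pow c 2 by rewrite /pow /= tnormx1.
  case: uv => -[-> ->].
    apply: (@le_trans _ _ (T (T (pow c m) (pow c k)) (T c c))).
      by apply: tnorm_homol; exact: tnorm_le.
    rewrite ccE -!powD; apply: (@le_trans _ _ (T (pow c k.+1) (pow c m.+1))).
      by rewrite -powD addn2 addSnnS addnS addnS addnC.
    exact: tnorm_le.
  apply: (@le_trans _ _ (T (T (pow c k) (pow c m)) (T c c))).
    by apply: tnorm_homol; exact: tnorm_le.
  rewrite ccE -!powD; apply: (@le_trans _ _ (T (pow c m.+1) (pow c k.+1))).
    by rewrite -powD addn2 addSnnS addnS addnS addnC.
  exact: tnorm_le.
have main u v : (u = x /\ v = y) \/ (u = y /\ v = x) -> T u v <= T v u.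
  move=> uv.
  have <- : T (T u v) (T b b) = T u v.
    rewrite bb; apply: (tnorm_idemE bb _).1.
    apply: le_trans (tnorm_lel _ _) _.
    by case: uv => -[-> _] //; exact: le_trans yb.
  rewrite -{1 2}(supI_lt ltyb).
  apply: (@continuous_supI_le _ (fun c => T (T u v) (T c c))).
  - apply: tnorm_continuous2; first exact: cst_continuous.
    by apply: tnorm_continuous2 => z; exact: cvg_id.
  - by exists y; rewrite /= lexx.
  - by move=> c yc; exact: squeeze.
by split; apply: main; [left|right].
Qed.

Lemma tnormC : commutative T.
Proof.
suff H x y : x <= y -> T x y = T y x.
  by move=> x y; have [/H//|/ltW/H] := leP x y.
move=> xy; have [[e [ee [xe ey]]]|noe] :=
  pselect (exists e, T e e = e /\ x <= e /\ e <= y).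
  have [xeE exE] := tnorm_idemE ee xe.
  have xyx : T x y = x.
    by apply/le_anti; rewrite tnorm_lel -{1}xeE tnorm_homor.
  have yxx : T y x = x.
    by apply/le_anti; rewrite tnorm_ler -{1}exE tnorm_homol.
  by rewrite xyx yxx.
apply/le_anti/andP; apply: tnormC_le => // e ee xe ey.
by apply: noe; exists e.
Qed.

End TNormTheory.

Record enriched_category (R : realType) (T : tnorm R) := EnrichedCategory {
  ecat_obj :> Type;
  ecat_hom : ecat_obj -> ecat_obj -> unitI R;
  ecat_id : forall x, ecat_hom x x = unitI1 R;
  ecat_comp : forall x y z,
    T (ecat_hom y z) (ecat_hom x y) <= ecat_hom x z
}.

Section Symmetrization.
Variables (R : realType) (T : tnorm R) (X : enriched_category T).

Definition sym_hom (x y : X) : unitI R :=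
  Num.min (ecat_hom x y) (ecat_hom y x).

Lemma sym_hom_id x : sym_hom x x = unitI1 R.
Proof. by rewrite /sym_hom ecat_id minxx. Qed.

Lemma sym_hom_comp x y z : T (sym_hom y z) (sym_hom x y) <= sym_hom x z.
Proof.
rewrite /sym_hom le_min; apply/andP; split.
  apply: le_trans _ (ecat_comp x y z).
  by apply: tnorm_le; rewrite ge_min lexx.
rewrite tnormC; apply: le_trans _ (ecat_comp z y x).
by apply: tnorm_le; rewrite ge_min lexx orbT.
Qed.

Definition symmetrization : enriched_category T :=
  EnrichedCategory sym_hom_id sym_hom_comp.

End Symmetrization.

Section OpenBallTopology.
Variables (R : realType) (T : tnorm R) (X : enriched_category T).

Definition oball (x : X) (r : unitI R) : set X := [set y | r < ecat_hom x y].

Definition oball_base : set (set X) :=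
  [set B | exists x r, r < unitI1 R /\ B = oball x r].

Definition open_ball_space : Type := X.

HB.instance Definition _ := gen_eqMixin open_ball_space.
HB.instance Definition _ := gen_choiceMixin open_ball_space.

Lemma oball_cover : \bigcup_(B in oball_base) B = setT.
Proof.
apply/seteqP; split => // x _; exists (oball x (unitI0 R)).
  by exists x, (unitI0 R); split => //; exact: unitI_lt01.
by rewrite /oball /= ecat_id; exact: unitI_lt01.
Qed.

Lemma oball_sub x r y : r < unitI1 R -> oball x r y ->
  exists2 u, u < unitI1 R & oball y u `<=` oball x r.
Proof.
move=> r1 rxy.
suff [u u1 ru] : exists2 u, u < unitI1 R & r < T u (ecat_hom x y).
  exists u => // z uyz; apply: lt_le_trans ru _.
  by apply: le_trans (tnorm_homol T _ _) (ecat_comp x y z); exact: ltW.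
apply: contrapT => nu.
have : T (unitI1 R) (ecat_hom x y) <= r.
  rewrite -(supI_lt (unitI_lt01 R)); apply: (@continuous_supI_le _ (T^~ (ecat_hom x y))).
  - exact: tnorm_continuousl.
  - by exists (unitI0 R); rewrite /= lexx unitI_lt01.
  move=> u /andP[_ u1]; rewrite leNgt; apply/negP => ru.
  by apply: nu; exists u.
by rewrite tnorm1x leNgt rxy.
Qed.

Lemma oball_join (A B : set X) x : oball_base A -> oball_base B ->
  A x -> B x -> exists C, [/\ oball_base C, C x & C `<=` A `&` B].
Proof.
move=> [a [r [r1 ->]]] [b [s [s1 ->]]] ax bx.
have [u u1 uA] := oball_sub r1 ax; have [v v1 vB] := oball_sub s1 bx.
exists (oball x (Num.max u v)); split.
- by exists x, (Num.max u v); split => //; rewrite gt_max u1.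
- by rewrite /oball /= ecat_id gt_max u1.
- by move=> z; rewrite /oball /= gt_max => /andP[/uA ? /vB].
Qed.

HB.instance Definition _ :=
  isBaseTopological.Build open_ball_space oball_cover oball_join.

End OpenBallTopology.

Record directed_set := DirectedSet {
  dset_idx :> Type;
  dset_le : dset_idx -> dset_idx -> Prop;
  dset_inhabited : inhabited dset_idx;
  dset_refl : forall i, dset_le i i;
  dset_trans : forall j i k, dset_le i j -> dset_le j k -> dset_le i k;
  dset_directed : forall i j, exists k, dset_le i k /\ dset_le j k
}.

(* The filter of tails: a net [x : D -> Y] converges to [a] if and only if
   [x @ net_filter D --> a]. *)
Definition net_filter (D : directed_set) : set_system D :=
  filter_from [set: D] (fun i => [set j | dset_le i j]).

Arguments net_filter : clear implicits.

Section SmythComplete.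
Variables (R : realType) (T : tnorm R) (X : enriched_category T).

Definition forward_Cauchy (D : directed_set) (x : D -> X) : Prop :=
  supI [set infI [set ecat_hom (x p.1) (x p.2) |
                  p in [set p : D * D | dset_le i p.1 /\ dset_le p.1 p.2]]
       | i in [set: D]] = unitI1 R.

Definition Smyth_complete : Prop :=
  forall (D : directed_set) (x : D -> X), forward_Cauchy x ->
    exists! a : open_ball_space (symmetrization X),
      (x : D -> open_ball_space (symmetrization X)) @ net_filter D --> a.

End SmythComplete.

Record rv_space (R : realType) (T : tnorm R) := RvSpace {
  rv_point :> Type;
  rv_delta : rv_point -> set rv_point -> unitI R;
  rv_delta1 : forall x, rv_delta x [set x] = unitI1 R;
  rv_delta0 : forall x, rv_delta x set0 = unitI0 R;
  rv_deltaU : forall x A B,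
    rv_delta x (A `|` B) = Num.max (rv_delta x A) (rv_delta x B);
  rv_delta_trans : forall x A B,
    T (infI [set rv_delta b A | b in B]) (rv_delta x B) <= rv_delta x A
}.

Definition rv_continuous (R : realType) (T : tnorm R) (X Y : rv_space T)
    (f : X -> Y) : Prop :=
  forall x A, rv_delta x A <= rv_delta (f x) (f @` A).

Section SpaceK.
Variables (R : realType) (T : tnorm R).
Implicit Types (x : unitI R) (A B : set (unitI R)).

Definition K_delta x A : unitI R :=
  if A == set0 then unitI0 R else tnorm_imp T (infI A) x.

Lemma K_delta0 x : K_delta x set0 = unitI0 R.
Proof. by rewrite /K_delta eqxx. Qed.

Lemma K_deltaE x A : A !=set0 -> K_delta x A = tnorm_imp T (infI A) x.
Proof. by move=> /set0P; rewrite /K_delta => /negbTE ->. Qed.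

Lemma K_delta1 x : K_delta x [set x] = unitI1 R.
Proof.
rewrite K_deltaE; last by exists x.
apply/le_anti; rewrite unitI_le1 tnorm_impP tnormx1.
by apply: infI_lb.
Qed.

Lemma K_deltaU x A B :
  K_delta x (A `|` B) = Num.max (K_delta x A) (K_delta x B).
Proof.
have [->|/set0P A0] := eqVneq A set0.
  by rewrite set0U K_delta0 max_r// unitI_ge0.
have [->|/set0P B0] := eqVneq B set0.
  by rewrite setU0 K_delta0 max_l// unitI_ge0.
have AB0 : (A `|` B) !=set0 by case: A0 => a Aa; exists a; left.
rewrite !K_deltaE//.
have -> : infI (A `|` B) = Num.min (infI A) (infI B).
  apply/le_anti/andP; split.
    rewrite le_min; apply/andP; split.
      by apply: le_infI => a Aa; apply: infI_lb; left.
    by apply: le_infI => b Bb; apply: infI_lb; right.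
  apply: le_infI => z [Az|Bz]; first by rewrite ge_min infI_lb.
  by rewrite ge_min (infI_lb Bz) orbT.
have anti y z : y <= z -> tnorm_imp T z x <= tnorm_imp T y x.
  move=> yz; rewrite tnorm_impP.
  apply: le_trans (tnorm_homol T _ yz) _.
  by rewrite -tnorm_impP.
have [le|/ltW le] := leP (infI A) (infI B).
  by rewrite max_l// anti.
by rewrite max_r// anti.
Qed.

Lemma K_delta_trans x A B :
  T (infI [set K_delta b A | b in B]) (K_delta x B) <= K_delta x A.
Proof.
have [->|/set0P B0] := eqVneq B set0.
  by rewrite K_delta0 tnormx0 unitI_ge0.
have [->|/set0P A0] := eqVneq A set0.
  rewrite K_delta0; have [b Bb] := B0; apply: le_trans (tnorm_lel _ _ _) _.
  by apply: infI_lb; exists b => //; exact: K_delta0.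
rewrite !K_deltaE// tnorm_impP tnormA.
set p := infI _.
apply: (@le_trans _ _ (T (infI B) (tnorm_imp T (infI B) x))).
  apply: tnorm_homol; apply: le_infI => b Bb; rewrite -tnorm_impP.
  by apply: infI_lb; exists b => //; rewrite K_deltaE.
by rewrite -tnorm_impP.
Qed.

Definition space_K : rv_space T :=
  RvSpace K_delta1 K_delta0 K_deltaU K_delta_trans.

End SpaceK.

Section Sober.
Variables (R : realType) (T : tnorm R).

Definition sub_fun (X : Type) (f g : X -> unitI R) : unitI R :=
  infI (range (fun x => tnorm_imp T (f x) (g x))).

Variable X : rv_space T.

Definition rv_closed (f : X -> unitI R) : Prop :=
  rv_continuous (f : X -> space_K T).

(* Explicit form of: [sub_fun phi] preserves finite enriched colimits, that is,
   tensors and binary joins of closed sets. *)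
Definition rv_irreducible (phi : X -> unitI R) : Prop :=
  rv_closed phi /\
  forall (f g : X -> unitI R) (r : unitI R), rv_closed f -> rv_closed g ->
    sub_fun phi (fun x => T r (f x)) = T r (sub_fun phi f) /\
    sub_fun phi (fun x => Num.max (f x) (g x)) =
      Num.max (sub_fun phi f) (sub_fun phi g).

Definition rv_sober : Prop :=
  forall phi : X -> unitI R, rv_irreducible phi ->
    exists! x : X, phi = (fun y => rv_delta y [set x]).

End Sober.

Section Alexandroff.
Variables (R : realType) (T : tnorm R) (X : enriched_category T).
Implicit Types (x : X) (A B : set X).

(* [supI set0] is 0, which covers the case where [A] is empty. *)
Definition Gamma_delta x A : unitI R := supI [set ecat_hom x y | y in A].

Lemma Gamma_delta1 x : Gamma_delta x [set x] = unitI1 R.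
Proof.
apply/le_anti; rewrite unitI_le1 -(ecat_id x).
by apply: supI_ub; exists x.
Qed.

Lemma Gamma_delta0 x : Gamma_delta x set0 = unitI0 R.
Proof. by rewrite /Gamma_delta image_set0 /supI supremum0. Qed.

Lemma Gamma_deltaU x A B :
  Gamma_delta x (A `|` B) = Num.max (Gamma_delta x A) (Gamma_delta x B).
Proof.
apply/le_anti/andP; split.
  apply: supI_le => _ [y [Ay|By] <-]; rewrite le_max.
    by rewrite supI_ub//; exists y.
  by rewrite orbC supI_ub//; exists y.
rewrite ge_max; apply/andP; split; apply: supI_le => _ [y Cy <-].
  by apply: supI_ub; exists y => //; left.
by apply: supI_ub; exists y => //; right.
Qed.

Lemma Gamma_delta_trans x A B :
  T (infI [set Gamma_delta b A | b in B]) (Gamma_delta x B) <= Gamma_delta x A.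
Proof.
apply: tnorm_supI_le => _ [b Bb <-].
apply: (@le_trans _ _ (T (Gamma_delta b A) (ecat_hom x b))).
  by apply: tnorm_homol; apply: infI_lb; exists b.
rewrite tnormC; apply: tnorm_supI_le => _ [y Ay <-].
rewrite tnormC; apply: le_trans _ (ecat_comp x b y) _.
by apply: supI_ub; exists y.
Qed.

Definition Gamma : rv_space T :=
  RvSpace Gamma_delta1 Gamma_delta0 Gamma_deltaU Gamma_delta_trans.

End Alexandroff.

(* Main.v *)
Require Import Defs.
From mathcomp Require Import all_boot all_order all_algebra.
From mathcomp Require Import all_classical all_reals topology normedtype.

(** A closed set of [Gamma X] is the same thing as a weight of [X]: a function
    [f] with [T (X x y) (f y) <= f x].  The theorem holds because the irreducible
    weights are exactly those of the form [phi = liminf_j X(-, x_j)] for a forward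
    Cauchy net [x], and because such a [phi] is representable, by [a], exactly when
    [x] converges to [a] in the symmetrization ([net_weight_representableP]).
    Existence and uniqueness of a limit thus become existence and uniqueness of a
    representing point.

    A forward Cauchy net has an irreducible weight ([net_weight_irreducible])
    since [sub (phi, f) = liminf_j f (x_j)] for every weight [f], and along the
    net [f] is almost decreasing: the limit inferior is then a genuine limit and
    commutes with binary joins, while it commutes with tensors by continuity of
    the t-norm.

    Conversely ([irreducible_net_weight]), an irreducible [phi] is the weight of
    the net of all formal balls [(x, r)] with [r < phi x], where [(x, r)] precedes
    [(y, s)] if [r <= T s (X x y)].  Directedness is the point where joins enter:
    applied to the weights [X(x, -) -> r] and [X(y, -) -> s], irreducibility yields
    a single [z] with [r < T (phi z) (X x z)] and [s < T (phi z) (X y z)]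
    ([irreducible_amalgam]), and continuity of the t-norm lowers [phi z] to a
    radius strictly below it.  Compatibility with tensors gives [phi] values
    arbitrarily close to 1 ([irreducible_inhabited]), which makes the net forward
    Cauchy. *)

Set Implicit Arguments.
Unset Strict Implicit.
Unset Printing Implicit Defensive.
Import Order.TTheory GRing.Theory Num.Theory.
Local Open Scope classical_set_scope.
Local Open Scope ring_scope.

(** * Approximation in the unit interval *)

Section Approximation.
Variables (R : realType) (T : tnorm R).
Implicit Types a b c q r : unitI R.

Lemma tnorm_lt_approx a b r : r < T a b -> exists2 q, q < a & r < T q b.
Proof.
move=> rab; have ra : r < a := lt_le_trans rab (tnorm_lel T a b).
apply: contrapT => nq; move: rab; rewrite ltNge => /negP; apply.
rewrite -{1}(supI_lt ra); apply: (@continuous_supI_le _ (T^~ b)).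
- exact: tnorm_continuousl.
- by exists r; rewrite /= lexx.
- by move=> q /andP[_ qa]; rewrite leNgt; apply/negP => rq; apply: nq; exists q.
Qed.

Lemma le_tnorm_approx a b : (forall c, c < unitI1 R -> T c a <= b) -> a <= b.
Proof.
move=> Tab; rewrite leNgt; apply/negP => ba.
have := ba; rewrite -{1}(tnorm1x T a) => /tnorm_lt_approx[c c1].
by rewrite ltNge Tab.
Qed.

Lemma le_lt_approx a b : (forall c, c < a -> c <= b) -> a <= b.
Proof.
move=> ab; rewrite leNgt; apply/negP => /unitI_dense[c bc /ab].
by rewrite leNgt bc.
Qed.

Lemma tnorm_infI_le r (A : set (unitI R)) c : A !=set0 ->
  (forall a, A a -> c <= T r a) -> c <= T r (infI A).
Proof. by apply: continuous_infI_ge; exact: tnorm_continuousr. Qed.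

Lemma le_sub_fun (Y : Type) (f g : Y -> unitI R) c :
  c <= sub_fun T f g <-> forall y, T c (f y) <= g y.
Proof.
split=> [cs y|cfg].
  rewrite tnormC -tnorm_impP; apply: le_trans cs _.
  by apply: infI_lb; exists y.
by apply: le_infI => _ [y _ <-]; rewrite tnorm_impP tnormC.
Qed.

End Approximation.

(** * Limits inferior along nets *)

Section NetLiminf.
Variables (R : realType) (D : directed_set).
Implicit Types (u v : D -> unitI R) (c : unitI R).

Definition net_liminf u : unitI R :=
  supI [set infI [set u j | j in [set j | dset_le i j]] | i in [set: D]].

Lemma le_net_liminf u i c :
  (forall j, dset_le i j -> c <= u j) -> c <= net_liminf u.
Proof.
move=> cu; apply: (@le_trans _ _ (infI [set u j | j in [set j | dset_le i j]])).
  by apply: le_infI => _ [j /= ij <-]; exact: cu.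
by apply: supI_ub; exists i.
Qed.

Lemma net_liminf_le u c :
  (forall i b, (forall j, dset_le i j -> b <= u j) -> b <= c) ->
  net_liminf u <= c.
Proof.
move=> uc; apply: supI_le => _ [i _ <-]; apply: (uc i) => j ij.
by apply: infI_lb; exists j.
Qed.

Lemma net_liminf_homo u v : (forall j, u j <= v j) ->
  net_liminf u <= net_liminf v.
Proof.
move=> uv; apply: net_liminf_le => i b bu; apply: (@le_net_liminf _ i) => j ij.
exact: le_trans (bu j ij) (uv j).
Qed.

(** By continuity, [T r] preserves infima of the nonempty tails as well as
    suprema. *)
Lemma net_liminf_tnorm (T : tnorm R) r u :
  net_liminf (fun j => T r (u j)) = T r (net_liminf u).
Proof.
apply/le_anti/andP; split.
  apply: net_liminf_le => i b bu.
  apply: (@le_trans _ _ (T r (infI [set u j | j in [set j | dset_le i j]]))).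
    apply: tnorm_infI_le => [|_ [j ij <-]]; last exact: bu.
    by exists (u i), i => //; exact: dset_refl.
  apply: tnorm_homor; apply: (@le_net_liminf _ i) => j ij.
  by apply: infI_lb; exists j.
rewrite -tnorm_impP; apply: net_liminf_le => i b bu; rewrite tnorm_impP.
by apply: (@le_net_liminf _ i) => j ij; apply: tnorm_homor; exact: bu.
Qed.

End NetLiminf.

(** * Forward Cauchy nets and their weights *)

Section NetWeight.
Variables (R : realType) (T : tnorm R) (X : enriched_category T).
Implicit Types (a y : X) (f g : X -> unitI R) (c : unitI R).

Lemma forward_CauchyP (D : directed_set) (x : D -> X) :
  forward_Cauchy x <-> forall c, c < unitI1 R -> exists i, forall j k,
    dset_le i j -> dset_le j k -> c <= ecat_hom (x j) (x k).
Proof.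
split=> [fx c c1|xc].
  apply: contrapT => nc; have [d cd d1] := unitI_dense c1.
  have : forward_Cauchy x by [].
  suff : supI [set infI [set ecat_hom (x p.1) (x p.2) |
                  p in [set p : D * D | dset_le i p.1 /\ dset_le p.1 p.2]]
       | i in [set: D]] <= d.
    by move=> + e; rewrite e leNgt d1.
  apply: supI_le => _ [i _ <-]; rewrite leNgt; apply/negP => di; apply: nc.
  exists i => j k ij jk; apply: (le_trans (ltW (lt_trans cd di))).
  by apply: infI_lb; exists (j, k).
apply/le_anti; rewrite unitI_le1 /=; apply: le_lt_approx => c /xc[i ic].
apply: le_trans (supI_ub _); last by exists i.
by apply: le_infI => _ [[j k] /= [ij jk] <-]; exact: ic.
Qed.

Lemma net_cvgP (D : directed_set) (x : D -> X) a :
  (x : D -> open_ball_space (symmetrization X)) @ net_filter D -->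
    (a : open_ball_space (symmetrization X)) <->
  forall c, c < unitI1 R -> exists i, forall j, dset_le i j ->
    c <= ecat_hom a (x j) /\ c <= ecat_hom (x j) a.
Proof.
split=> [xa c c1|xa].
  have /xa[i _ ix] : nbhs (a : open_ball_space (symmetrization X))
      (oball (a : symmetrization X) c).
    rewrite nbhsE; exists (oball (a : symmetrization X) c) => //; split.
      exists [set oball (a : symmetrization X) c]; last by rewrite bigcup_set1.
      by move=> _ ->; exists a, c.
    by rewrite /oball /= sym_hom_id.
  exists i => j /ix; rewrite /oball /= /sym_hom lt_min => /andP[ax xa'].
  by rewrite !ltW.
move=> A; rewrite nbhsE => -[_ [[F Fb <-] [B FB Ba]] BA].
have [y [r [r1 BE]]] := Fb _ FB.
have [c c1 cB] : exists2 c, c < unitI1 R &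
    oball (a : symmetrization X) c `<=` B.
  by rewrite BE; apply: oball_sub => //; rewrite -BE.
have [d cd d1] := unitI_dense c1.
have [i ix] := xa d d1; exists i => // j /ix[da dx].
apply: BA; exists B => //; apply: cB.
by rewrite /oball /= /sym_hom lt_min !(lt_le_trans cd).
Qed.

(** It suffices to test continuity on singletons because [Gamma_delta x] and
    the tensor both preserve suprema. *)
Lemma Gamma_closedP f : rv_closed (X := Gamma X) f <->
  forall y z, T (ecat_hom y z) (f z) <= f y.
Proof.
split=> [fc y z|fw y A].
  rewrite tnormC -tnorm_impP.
  have := fc y [set z]; rewrite /= K_deltaE; last by exists (f z), z.
  rewrite image_set1; have -> : infI [set f z] = f z.
    by apply/le_anti; rewrite infI_lb //=; apply: le_infI => _ ->.
  by apply: le_trans; apply: supI_ub; exists z.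
have [->|/set0P A0] := eqVneq A set0; first by rewrite rv_delta0 unitI_ge0.
rewrite /= K_deltaE; last by case: A0 => z Az; exists (f z), z.
rewrite tnorm_impP; apply: tnorm_supI_le => _ [z Az <-].
rewrite tnormC; apply: le_trans (fw y z); apply: tnorm_homor.
by apply: infI_lb; exists z.
Qed.

Lemma Gamma_delta_point y a : Gamma_delta y [set a] = ecat_hom y a.
Proof.
apply/le_anti/andP; split; first by apply: supI_le => _ [_ -> <-].
by apply: supI_ub; exists a.
Qed.

Section Net.
Variables (D : directed_set) (x : D -> X).

Definition net_weight y : unitI R := net_liminf (fun j => ecat_hom y (x j)).

Lemma net_weight_closed : rv_closed (X := Gamma X) net_weight.
Proof.
apply/Gamma_closedP => y z; rewrite -net_liminf_tnorm.
by apply: net_liminf_homo => j; rewrite tnormC; exact: ecat_comp.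
Qed.

Hypothesis fCx : forward_Cauchy x.

Lemma net_weight_eventually c : c < unitI1 R ->
  exists i, forall j, dset_le i j -> c <= net_weight (x j).
Proof.
have /forward_CauchyP xc := fCx.
by move=> /xc[i ic]; exists i => j ij; apply: (@le_net_liminf _ _ _ j) => k; exact: ic.
Qed.

(** The net eventually lies where its weight is close to 1, so [sub] is nearly
    below [f (x_j)] for large [j].  Conversely, if [b <= f (x_j)] eventually, then
    [b & X(y, x_j) <= f y] because [f] is a weight, and passing to the limit
    inferior gives [b & net_weight y <= f y]. *)
Lemma sub_net_weight f : rv_closed (X := Gamma X) f ->
  sub_fun T net_weight f = net_liminf (f \o x).
Proof.
move=> /Gamma_closedP fw; apply/le_anti/andP; split.
  apply: (@le_tnorm_approx _ T) => c /net_weight_eventually[i ic].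
  apply: (@le_net_liminf _ _ _ i) => j ij; rewrite tnormC.
  apply: (@le_trans _ _ (T (sub_fun T net_weight f) (net_weight (x j)))).
    by apply: tnorm_homor; exact: ic.
  by have /le_sub_fun := lexx (sub_fun T net_weight f); exact.
apply: net_liminf_le => i b bf; apply/le_sub_fun => y; rewrite -tnorm_impP.
apply: net_liminf_le => i' b' b'x; rewrite tnorm_impP tnormC.
have [k [ik i'k]] := dset_directed i i'.
by apply: le_trans (fw y (x k)); apply: tnorm_le; [exact: b'x|exact: bf].
Qed.

(** Since [f] is contravariant, [X(x_j, x_k)] close to 1 pushes [f (x_k)] below
    [f (x_j)] up to a factor [c]. *)
Lemma net_closed_almost_decreasing f c : rv_closed (X := Gamma X) f ->
  c < unitI1 R -> exists i, forall j k, dset_le i j -> dset_le j k ->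
    T c (f (x k)) <= f (x j).
Proof.
move=> /Gamma_closedP fw; have /forward_CauchyP xc := fCx => /xc[i ic].
exists i => j k ij jk; apply: le_trans (fw (x j) (x k)).
by apply: tnorm_homol; exact: ic.
Qed.

(** If the maximum of two weights is eventually at least [b], then one of them
    is at least [b] cofinally, and an almost decreasing net which is cofinally
    large is eventually large. *)
Lemma net_liminf_max f g : rv_closed (X := Gamma X) f ->
  rv_closed (X := Gamma X) g ->
  net_liminf (fun j => Num.max (f (x j)) (g (x j))) =
    Num.max (net_liminf (f \o x)) (net_liminf (g \o x)).
Proof.
move=> fw gw; apply/le_anti/andP; split; last first.
  rewrite ge_max; apply/andP; split; apply: net_liminf_homo => j /=.
    by rewrite le_max lexx.
  by rewrite le_max lexx orbT.
have cofinal h b : rv_closed (X := Gamma X) h ->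
    (forall i, exists2 j, dset_le i j & b <= h (x j)) ->
    b <= net_liminf (h \o x).
  move=> hw hb; apply: (@le_tnorm_approx _ T) => c c1.
  have [i ic] := net_closed_almost_decreasing hw c1.
  apply: (@le_net_liminf _ _ _ i) => j ij; have [k jk bk] := hb j.
  by apply: le_trans (ic j k ij jk); exact: tnorm_homor.
apply: net_liminf_le => i b bfg; rewrite le_max; apply/orP.
have [fb|nfb] := pselect (forall i, exists2 j, dset_le i j & b <= f (x j)).
  by left; exact: cofinal.
right; apply: cofinal => // i1.
have [i2 fi2] : exists i2, forall j, dset_le i2 j -> f (x j) < b.
  apply: contrapT => nf; apply: nfb => i2; apply: contrapT => nj; apply: nf.
  by exists i2 => j ij; rewrite ltNge; apply/negP => bj; apply: nj; exists j.
have [k1 [ik1 i1k1]] := dset_directed i i1.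
have [k [k1k i2k]] := dset_directed k1 i2.
exists k; first exact: dset_trans k1k.
have := bfg k (dset_trans ik1 k1k); rewrite le_max => /orP[|//].
by rewrite leNgt fi2.
Qed.

Lemma net_weight_irreducible : rv_irreducible (X := Gamma X) net_weight.
Proof.
split=> [|f g r fw gw]; first exact: net_weight_closed.
have closedT : rv_closed (X := Gamma X) (fun y => T r (f y)).
  apply/Gamma_closedP => y z; have /Gamma_closedP fyz := fw.
  rewrite tnormA [T (ecat_hom y z) r]tnormC -tnormA.
  by apply: tnorm_homor; exact: fyz.
have closedU : rv_closed (X := Gamma X) (fun y => Num.max (f y) (g y)).
  apply/Gamma_closedP => y z.
  have /Gamma_closedP fyz := fw; have /Gamma_closedP gyz := gw.
  have [_|_] := leP (f z) (g z); rewrite le_max ?fyz ?gyz ?orbT //.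
rewrite !sub_net_weight //; split; first exact: net_liminf_tnorm.
exact: net_liminf_max.
Qed.

(** Convergence to [a] says that [X(a, x_j)] and [X(x_j, a)] both tend to 1.
    Under [net_weight = X(-, a)] the first is the value 1 of the weight at [a],
    the second is [net_weight_eventually]. *)
Lemma net_weight_representableP a :
  (x : D -> open_ball_space (symmetrization X)) @ net_filter D -->
    (a : open_ball_space (symmetrization X)) <->
  net_weight = (fun y => rv_delta (r := Gamma X) y [set a]).
Proof.
have -> : (fun y => rv_delta (r := Gamma X) y [set a]) = (fun y => ecat_hom y a).
  by apply/funext => y; exact: Gamma_delta_point.
rewrite net_cvgP; split=> [xa|wa c c1].
  apply/funext => y; apply/le_anti/andP; split.
    apply: net_liminf_le => i b bx; apply: (@le_tnorm_approx _ T) => c /xa[i' i'c].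
    have [k [ik i'k]] := dset_directed i i'.
    apply: le_trans (ecat_comp y (x k) a).
    by apply: tnorm_le; [have [] := i'c k i'k|exact: bx].
  apply: (@le_tnorm_approx _ T) => c /xa[i ic].
  apply: (@le_net_liminf _ _ _ i) => j /ic[caj _].
  by apply: le_trans (ecat_comp y a (x j)); exact: tnorm_homol.
have [i ci] := net_weight_eventually c1.
have [i' ci'] : exists i', forall j, dset_le i' j -> c <= ecat_hom a (x j).
  apply: contrapT => nc; move: (congr1 (@^~ a) wa); rewrite ecat_id => w1.
  suff : net_weight a <= c by rewrite w1 leNgt c1.
  apply: net_liminf_le => i' b bx; rewrite leNgt; apply/negP => cb; apply: nc.
  by exists i' => j ij; apply: le_trans (ltW cb) (bx j ij).
have [k [ik i'k]] := dset_directed i i'.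
exists k => j kj; split; first by apply: ci'; exact: dset_trans kj.
by have := ci j (dset_trans ik kj); rewrite wa.
Qed.

End Net.

(** * The net of an irreducible weight *)

Section Irreducible.
Variables (phi : X -> unitI R) (phi_irr : rv_irreducible (X := Gamma X) phi).

Lemma irreducible_weight y z : T (ecat_hom y z) (phi z) <= phi y.
Proof. by have [/Gamma_closedP + _] := phi_irr; exact. Qed.

(** If [phi <= c] then [sub (phi, c & 1) = 1], whereas compatibility with the
    tensor bounds it by [c]. *)
Lemma irreducible_inhabited c : c < unitI1 R -> exists y, c < phi y.
Proof.
move=> c1; apply: contrapT => np; move: c1; rewrite ltNge => /negP; apply.
have cst1 : rv_closed (X := Gamma X) (fun=> unitI1 R).
  by apply/Gamma_closedP => y z; exact: unitI_le1.
apply: le_trans (tnorm_lel T c (sub_fun T phi (fun=> unitI1 R))).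
have [_ /(_ _ _ c cst1 cst1)[<- _]] := phi_irr.
apply/le_sub_fun => y; rewrite tnorm1x tnormx1 leNgt; apply/negP => cy.
by apply: np; exists y.
Qed.

(** These are the test weights of the amalgamation below: by currying,
    [sub (phi, X(y, -) -> r) = phi y -> r]. *)
Lemma hom_imp_closed y r :
  rv_closed (X := Gamma X) (fun z => tnorm_imp T (ecat_hom y z) r).
Proof.
apply/Gamma_closedP => z w; rewrite tnorm_impP.
rewrite tnormA; apply: (@le_trans _ _
  (T (ecat_hom y w) (tnorm_imp T (ecat_hom y w) r))).
  by apply: tnorm_homol; rewrite tnormC; exact: ecat_comp.
by rewrite -tnorm_impP.
Qed.

(** If no such [w] existed, then [phi] would lie below the maximum of the weights
    [X(y, -) -> r] and [X(z, -) -> s].  Irreducibility puts it below one of the two,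
    that is, [phi y <= r] or [phi z <= s]. *)
Lemma irreducible_amalgam y r z s : r < phi y -> s < phi z ->
  exists w, r < T (phi w) (ecat_hom y w) /\ s < T (phi w) (ecat_hom z w).
Proof.
move=> ry sz; apply: contrapT => nw.
have sub1 v q : unitI1 R <= sub_fun T phi (fun w => tnorm_imp T (ecat_hom v w) q) ->
    phi v <= q.
  move=> /le_sub_fun/(_ v).
  by rewrite tnorm1x tnorm_impP ecat_id tnorm1x.
have : unitI1 R <= sub_fun T phi (fun w => Num.max
    (tnorm_imp T (ecat_hom y w) r) (tnorm_imp T (ecat_hom z w) s)).
  apply/le_sub_fun => w; rewrite tnorm1x le_max !tnorm_impP.
  rewrite ![T (ecat_hom _ _) _]tnormC; apply/orP.
  have [|rw] := leP (T (phi w) (ecat_hom y w)) r; first by left.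
  right; rewrite leNgt; apply/negP => sw.
  by apply: nw; exists w.
have [_ /(_ _ _ r (hom_imp_closed y r) (hom_imp_closed z s))[_ ->]] := phi_irr.
by rewrite le_max => /orP[/sub1|/sub1]; rewrite leNgt ?ry ?sz.
Qed.

Definition weight_ball : Type := {p : X * unitI R | p.2 < phi p.1}.

(** The order of formal balls: with [+] on distances for [T], it reads
    [d (x, y) <= r - s] for balls of radii [r] and [s] centred at [x] and [y],
    reverse inclusion of balls up to formality. *)
Definition weight_ball_le (p q : weight_ball) : Prop :=
  (sval p).2 <= T (sval q).2 (ecat_hom (sval p).1 (sval q).1).

Lemma weight_ball_inhabited : inhabited weight_ball.
Proof.
have [y y0] := irreducible_inhabited (unitI_lt01 R).
by constructor; exists (y, unitI0 R).
Qed.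

Lemma weight_ball_refl p : weight_ball_le p p.
Proof. by rewrite /weight_ball_le ecat_id tnormx1. Qed.

Lemma weight_ball_trans q p t :
  weight_ball_le p q -> weight_ball_le q t -> weight_ball_le p t.
Proof.
rewrite /weight_ball_le => pq qt; apply: le_trans pq _.
apply: le_trans (tnorm_homol T _ qt) _; rewrite -tnormA.
by apply: tnorm_homor; exact: ecat_comp.
Qed.

Lemma weight_ball_directed p q :
  exists t, weight_ball_le p t /\ weight_ball_le q t.
Proof.
case: p q => [[y r] ry] [[z s] sz]; rewrite /weight_ball_le /=.
have [w [/tnorm_lt_approx[r' r'w rr'] /tnorm_lt_approx[s' s'w ss']]] :=
  irreducible_amalgam ry sz.
have mw : (w, Num.max r' s').2 < phi (w, Num.max r' s').1.
  by rewrite /= gt_max r'w.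
exists (exist _ (w, Num.max r' s') mw); split => /=.
  by apply: le_trans (ltW rr') (tnorm_homol T _ _); rewrite le_max lexx.
by apply: le_trans (ltW ss') (tnorm_homol T _ _); rewrite le_max lexx orbT.
Qed.

Definition weight_ball_set : directed_set :=
  DirectedSet weight_ball_inhabited weight_ball_refl weight_ball_trans
    weight_ball_directed.

Definition weight_net (p : weight_ball_set) : X := (sval p).1.

Lemma weight_ball_hom (p q : weight_ball_set) : dset_le p q ->
  (sval p).2 <= ecat_hom (weight_net p) (weight_net q).
Proof. by move=> pq; apply: le_trans pq (tnorm_ler T _ _). Qed.

(** Radii increase along the order and bound the homs out of their centers, so
    past a ball [(y, c)] all homs are at least [c]. *)
Lemma weight_net_forward_Cauchy : forward_Cauchy weight_net.
Proof.
apply/forward_CauchyP => c /irreducible_inhabited[y cy].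
exists (exist _ (y, c) cy) => p q yp pq.
by apply: le_trans (weight_ball_hom pq); apply: le_trans yp (tnorm_lel T _ _).
Qed.

(** The ball [(y, r)] witnesses [r <= net_weight y] for every [r < phi y].
    Conversely, a bound on [X(y, -)] along the net can be read at a ball whose
    center [z] has [phi z] close to 1, where [X(y, z) & phi z <= phi y]. *)
Lemma net_weight_weight_net : net_weight weight_net = phi.
Proof.
apply/funext => y; apply/le_anti/andP; split.
  apply: net_liminf_le => p b bp; apply: (@le_tnorm_approx _ T) => c.
  move=> /irreducible_inhabited[z cz].
  have [q [pq zq]] := weight_ball_directed p (exist _ (z, c) cz).
  apply: le_trans (irreducible_weight y (weight_net q)); rewrite tnormC.
  apply: tnorm_le; first exact: bp.
  by apply: le_trans zq _; apply: le_trans (tnorm_lel T _ _) _; exact: ltW (svalP q).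
apply: le_lt_approx => r ry.
by apply: (@le_net_liminf _ weight_ball_set _ (exist _ (y, r) ry)) => q /weight_ball_hom.
Qed.

Lemma irreducible_net_weight : exists (D : directed_set) (x : D -> X),
  forward_Cauchy x /\ net_weight x = phi.
Proof.
exists weight_ball_set, weight_net; split.
  exact: weight_net_forward_Cauchy.
exact: net_weight_weight_net.
Qed.

End Irreducible.

End NetWeight.

Theorem theorem4p9 (R : realType) (T : tnorm R) (X : enriched_category T) :
  Smyth_complete X <-> rv_sober (Gamma X).
Proof.
split=> [sX phi /irreducible_net_weight[D [x [fCx <-]]]|sG D x fCx].
  have [a [xa ua]] := sX D x fCx; exists a.
  split=> [|b wb]; first exact/(net_weight_representableP fCx).
  by apply: ua; exact/(net_weight_representableP fCx).
have [a [wa ua]] := sG _ (net_weight_irreducible fCx); exists a.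
split=> [|b xb]; first exact/(net_weight_representableP fCx).
by apply: ua; exact/(net_weight_representableP fCx).
Qed.
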